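(* Let $q$ be a prime. Let $c, k, M$ be positive integers with $c < M < q$, and let $A(X) \in \mathbb{F}_q[X]$ be a nonzero polynomial with $\deg(A) < cq$ and $\mathsf{pdeg}(A) < k$. Then $$\left|\{\alpha \in \mathbb{F}_q : \mathsf{mult}(A, \alpha) \geq M\}\right| \leq \min\left( \frac{c}{M - c + 1}\cdot k + c,\; k\right).$$
   Context: For $A(X) \in \mathbb{F}_q[X]$, $A^{[\ell]}(X)$ is the $\ell$-th Hasse derivative (the coefficient of $Z^\ell$ in $A(X+Z)$ expanded in powers of $Z$). With $\Lambda(X) = X^q - X$, the $\ell$-th pseudoderivative is $A_{\langle \ell \rangle}(X) = A^{[\ell]}(X) \bmod \Lambda(X)$, and the pseudodegree is $\mathsf{pdeg}(A) = \max_{\ell \geq 0}\deg(A_{\langle \ell\rangle})$. For nonzero $A$ and $\alpha \in \mathbb{F}_q$, $\mathsf{mult}(A,\alpha)$ is the largest $r$ such that $(X-\alpha)^r$ divides $A(X)$. *)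

(* Defs.v *)
From mathcomp Require Import all_boot all_order all_algebra.
Set Implicit Arguments. Unset Strict Implicit. Unset Printing Implicit Defensive.
Import GRing.Theory.
Local Open Scope ring_scope.

(* Hasse derivative: MathComp's nderivn  p^`N(l)  (= coefficient of Z^l in p(X+Z)). *)
Definition Lambda (F : fieldType) (q : nat) : {poly F} := 'X^q - 'X.

Definition pseudoderiv (F : fieldType) (q l : nat) (A : {poly F}) : {poly F} :=
  A^`N(l) %% Lambda F q.

(* pseudodegree: max over l of deg(A_<l>); Hasse derivatives of order >= size A
   vanish, so the max over all l equals the max over l < size A.  Degree is
   (size p).-1 (the zero polynomial gets degree 0 here). *)
Definition pdeg (F : fieldType) (q : nat) (A : {poly F}) : nat :=
  (\max_(l < size A) (size (pseudoderiv q l A)).-1)%N.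

Definition mult (F : fieldType) (A : {poly F}) (a : F) : nat := mup a A.

(* Main.v *)
Require Import Defs.
From mathcomp Require Import all_boot all_order all_algebra perm finfield.
From mathcomp Require Import zify ring.
Import GRing.Theory Num.Theory.
Local Open Scope ring_scope.

(** In [{poly {poly F}}] write [x] for the variable of the coefficients,
    which is ['Y] below, and [u] or [t] for the outer variable ['X].

    The bound [d] on the pseudodegree of [A] gives [A = P (x, Lambda)],
    where [P] has degree at most [d] in [x] and less than [c] in [t]. If [A]
    had more than [d] roots of multiplicity [c], then the coefficients of
    [P] would vanish one after the other, which gives the bound [k].

    For the other bound, let [C (x, u) = P (x, u - x)], so that
    [A = C (x, x ^ q)]. At a root [a] of multiplicity [M < q] one has
    [x ^ q = a + (x - a) ^ q], hence [C (x, a)] also vanishes to order [M]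
    at [a]. Factoring the matrix of coefficients of [C] over its rank [r]
    gives [C = \sum_(s < r) f s (x) * w s (u)] with [r <= c]. Unless [a] is a
    root of a fixed [w s], which happens for fewer than [c] values of [a],
    the Wronskian of the [f s] vanishes to order [M - r + 1] at [a]. This
    Wronskian is nonzero because the [f s] are linearly independent of
    degree below [q], and it divides a nonzero determinant of size [r] whose
    entries are coefficients in [t] of derivatives of
    [C (x, x + t) = P (x, t)], hence has degree at most [r * d]. Degrees
    below [q] require [d + c <= q]; otherwise counting the roots of [A] with
    multiplicity is enough. *)

Set Implicit Arguments.
Unset Strict Implicit.

Section LinearIndependence.

Definition linearly_independent (R : nzRingType) (V : lmodType R) r
    (v : 'I_r -> V) : Prop :=
  forall a : 'I_r -> R, \sum_s a s *: v s = 0 -> forall s, a s = 0.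

Lemma linearly_independent_neq0 (R : nzRingType) (V : lmodType R) r
    (v : 'I_r -> V) s : linearly_independent v -> v s != 0.
Proof.
apply: contraPneq => vs0 /(_ (fun i => (i == s)%:R)) v_indep.
suff /v_indep/(_ s)/eqP : \sum_i (i == s)%:R *: v i = 0.
  by rewrite eqxx oner_eq0.
by apply: big1 => i _; case: eqP => [->|_]; rewrite ?vs0 ?scaler0 ?scale0r.
Qed.

Variable F : fieldType.

Lemma row_free_poly_rVP r n (f : 'I_r -> {poly F}) :
    (forall s, size (f s) <= n)%N ->
  reflect (linearly_independent f)
          (row_free (\matrix_s poly_rV (f s) : 'M_(r, n))).
Proof.
move=> f_n; set A := \matrix_s _.
have relE a : rVpoly (a *m A) = \sum_s a 0 s *: f s.
  rewrite mulmx_sum_row linear_sum; apply: eq_bigr => s _.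
  by rewrite linearZ rowK /= poly_rV_K.
apply: (iffP idP) => [A_free a fa0 s | f_indep].
  suff /rowP/(_ s) : \row_i a i = 0 by rewrite !mxE.
  apply/eqP; rewrite -(mulmx_free_eq0 _ A_free).
  rewrite -(inj_eq (can_inj (@rVpolyK _ _))) relE linear0.
  by apply/eqP; rewrite -[RHS]fa0; apply: eq_bigr => i _; rewrite mxE.
apply: inj_row_free => a /(congr1 rVpoly); rewrite relE linear0 => fa0.
by apply/rowP => s; rewrite mxE; exact: f_indep fa0 s.
Qed.

Lemma linearly_independent_rVpoly_row r n (A : 'M[F]_(r, n)) :
  row_free A -> linearly_independent (fun s => rVpoly (row s A)).
Proof.
move=> A_free; apply/(@row_free_poly_rVP _ n) => [s|]; first exact: size_poly.
rewrite (_ : \matrix_s _ = A) //.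
by apply/row_matrixP => s; rewrite rowK rVpolyK.
Qed.

End LinearIndependence.

Lemma size_derivn_leq (R : nzRingType) (p : {poly R}) l :
  (size p^`(l) <= size p)%N.
Proof.
apply/leq_sizeP => i p_i; rewrite coef_derivn nth_default ?mul0rn //.
exact: leq_trans p_i (leq_addl _ _).
Qed.

Lemma deriv_nderivn (R : nzRingType) (p : {poly R}) i :
  (p^`N(i))^`() = p^`N(i.+1) *+ i.+1.
Proof.
apply/polyP => a; rewrite coefMn coef_deriv !coef_nderivn addSn addnS -!mulrnA.
congr (_ *+ _); have := mul_bin_left (i + a).+1 i.
by rewrite subSn ?leq_addr // addKn; lia.
Qed.

Lemma coef_comp_XaddC (R : comNzRingType) (p : {poly R}) c i :
  (p \Po ('X + c%:P))`_i = p^`N(i).[c].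
Proof.
elim/poly_ind: p i => [|p a IHp] i.
  by rewrite comp_poly0 coef0 linear0 horner0.
rewrite comp_polyD comp_polyM comp_polyX comp_polyC mulrDr.
rewrite !coefD coefMX coefMC coefC !IHp; case: i => [|i] /=.
  by rewrite !nderivn0 hornerMXaddC add0r.
by rewrite nderivnMXaddC hornerD hornerMX addr0.
Qed.

Section BivariateSize.

Variable R : comNzRingType.
Implicit Types (p : {poly R}) (u : {poly {poly R}}).

Lemma sizeY_leqP u k :
  reflect (forall i, size (u`_i)%R <= k)%N (sizeY u <= k)%N.
Proof.
apply: (iffP idP) => [uk i | uk]; last by apply/bigmax_leqP => i _.
exact: leq_trans (max_size_coefXY _ _) uk.
Qed.

Lemma sizeY_MXaddC_leq u p k :
  (sizeY (u * 'X + p%:P)%R <= k)%N = (sizeY u <= k)%N && (size p <= k)%N.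
Proof.
apply/sizeY_leqP/andP => [upk | [/sizeY_leqP uk pk] i].
  split; last by have := upk 0%N; rewrite coefD coefMX coefC add0r.
  by apply/sizeY_leqP => i; have := upk i.+1; rewrite coefD coefMX coefC addr0.
by rewrite coefD coefMX coefC; case: i => [|i] /=; rewrite ?add0r ?addr0.
Qed.

Lemma size_horner_leq u p :
  (size (u.[p])%R <= sizeY u + (size u).-1 * (size p).-1)%N.
Proof.
rewrite horner_coef; apply: leq_trans (size_sum _ _ _) _.
apply/bigmax_leqP => i _.
have p_i : (size (p ^+ i)%R <= ((size u).-1 * (size p).-1).+1)%N.
  apply: leq_trans (size_poly_exp_leq _ _) _; rewrite ltnS mulnC leq_mul2r.
  by rewrite -ltnS (leq_trans _ (leqSpred _)) ?orbT.
apply: leq_trans (size_polyMleq _ _) _.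
by rewrite -subn1 leq_subLR add1n -addnS leq_add ?max_size_coefXY.
Qed.

Lemma sizeY_comp_XaddC u p :
  (sizeY (u \Po ('X + p%:P))%R <= sizeY u + (size u).-1 * (size p).-1)%N.
Proof.
apply/sizeY_leqP => i; rewrite coef_comp_XaddC.
apply: leq_trans (size_horner_leq _ _) _; apply: leq_add.
  apply/sizeY_leqP => j; rewrite coef_nderivn -scaler_nat.
  exact: leq_trans (size_scale_leq _ _) (max_size_coefXY _ _).
rewrite leq_mul2r -!subn1 leq_sub2r ?orbT //.
by apply: leq_trans (size_poly _ _) (leq_subr _ _).
Qed.

End BivariateSize.

Section TensorPoly.

Variable R : comNzRingType.

Definition tensor_poly r (f w : 'I_r -> {poly R}) : {poly {poly R}} :=
  \sum_s f s *: (w s)^:P.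

Lemma horner_tensor_poly r (f w : 'I_r -> {poly R}) a :
  (tensor_poly f w).[a%:P] = \sum_s (w s).[a] *: f s.
Proof.
rewrite horner_sum; apply: eq_bigr => s _.
by rewrite hornerZ horner_map mulrC mul_polyC.
Qed.

Lemma coef_tensor_poly_comp_XaddY r (f w : 'I_r -> {poly R}) i :
  (tensor_poly f w \Po ('X + 'Y))`_i = \sum_s f s * (w s)^`N(i).
Proof.
rewrite coef_comp_XaddC linear_sum horner_sum; apply: eq_bigr => s _ /=.
by rewrite linearZ /= hornerZ nderivn_map -[_.['X]]/(_ \Po 'X) comp_polyXr.
Qed.

End TensorPoly.

Lemma tensor_poly_rank_factorization (F : fieldType) (C : {poly {poly F}}) :
  exists r (f w : 'I_r -> {poly F}), (r <= size C)%N /\ [/\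
    linearly_independent f,
    linearly_independent w,
    forall s, (size (f s) <= sizeY C)%N,
    forall s, (size (w s) <= size C)%N
  & C = tensor_poly f w].
Proof.
pose Phi : 'M_(size C, sizeY C) := \matrix_i poly_rV C`_i.
pose f s := rVpoly (row s (row_base Phi)).
pose w s := rVpoly (row s (col_base Phi)^T).
exists (\rank Phi), f, w; split; first exact: rank_leq_row.
split; [| | by move=> s; apply: size_poly.. |].
- exact/linearly_independent_rVpoly_row/row_base_free.
- apply: linearly_independent_rVpoly_row; rewrite /row_free mxrank_tr.
  exact: col_base_full.
apply/polyP => i; rewrite coef_sum; under eq_bigr do rewrite coefZ coef_map /=.
have [i_C | C_i] := ltnP i (size C); last first.
  rewrite nth_default // big1 // => s _.
  by rewrite [X in X%:P]nth_default ?mulr0 // (leq_trans (size_poly _ _)).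
have -> : C`_i = rVpoly (row (Ordinal i_C) Phi).
  by rewrite rowK poly_rV_K ?max_size_coefXY.
rewrite -{1}(mulmx_base Phi) row_mul mulmx_sum_row linear_sum.
apply: eq_bigr => s _; rewrite linearZ /= mulrC mul_polyC; congr (_ *: _).
by rewrite (coef_rVpoly_ord _ (Ordinal i_C)) !mxE.
Qed.

Section Wronskian.

Variable R : idomainType.
Implicit Types p h : {poly R}.

Definition wronskian_mx r (f : 'I_r -> {poly R}) : 'M[{poly R}]_r :=
  \matrix_(s, j) (f s)^`(j).

Definition wronskian r (f : 'I_r -> {poly R}) : {poly R} :=
  \det (wronskian_mx f).

Lemma wronskian_eq0P r (f : 'I_r -> {poly R}) :
  reflect (exists2 g : 'I_r -> {poly R}, exists s, g s != 0
             & forall j, (j < r)%N -> \sum_s g s * (f s)^`(j) = 0)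
          (wronskian f == 0).
Proof.
apply: (iffP det0P) => [[v v0 vW] | [g [s gs0] gW]].
  exists (v 0) => [|j j_r]; first exact/rV0Pn.
  have /rowP/(_ (Ordinal j_r)) := vW; rewrite !mxE => vWj.
  by rewrite -[RHS]vWj; apply: eq_bigr => s _; rewrite mxE.
exists (\row_s g s); first by apply/rV0Pn; exists s; rewrite mxE.
apply/rowP => j; rewrite !mxE -[RHS](gW j) //.
by apply: eq_bigr => i _; rewrite !mxE.
Qed.

(* Differentiating the relation of order [j] and subtracting that of order [j.+1]
   shows that the [(g s)^`()] satisfy the same relations as the [g s], but one
   fewer; after elimination of [g ord0] only the trivial solution is left. *)
Lemma wronskian_minimal_relation r (f : 'I_r.+1 -> {poly R}) :
    wronskian (f \o lift ord0) != 0 -> wronskian f = 0 ->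
  exists g : 'I_r.+1 -> {poly R}, [/\ g ord0 != 0,
    forall s, g ord0 * (g s)^`() = (g ord0)^`() * g s & \sum_s g s * f s = 0].
Proof.
move=> W'_neq0 /eqP/wronskian_eq0P[g [s gs0] gf].
have only_trivial (u : 'I_r -> {poly R}) :
    (forall j, (j < r)%N -> \sum_i u i * (f (lift ord0 i))^`(j) = 0) ->
  forall i, u i = 0.
  move=> uf i; apply: contraNeq W'_neq0 => ui0.
  by apply/wronskian_eq0P; exists u => //; exists i.
have g'f j : (j < r)%N -> \sum_s (g s)^`() * (f s)^`(j) = 0.
  move=> j_r; have := congr1 deriv (gf j (ltnW j_r)).
  rewrite raddf_sum raddf0 /=; under eq_bigr do rewrite derivM -(derivnS (f _)).
  by rewrite big_split (gf j.+1 j_r) [LHS]addr0.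
exists g; split; last by have := gf 0%N isT; under eq_bigr do rewrite derivn0.
  apply: contraNneq gs0 => g0; apply/eqP; case: (unliftP ord0 s) => [i ->|-> //].
  move: i; apply: only_trivial => j j_r; have := gf j (ltnW j_r).
  by rewrite big_ord_recl g0 mul0r add0r.
move=> {gs0}s; apply/eqP; rewrite -subr_eq0; apply/eqP.
case: (unliftP ord0 s) => [i ->|->]; last by rewrite mulrC subrr.
move: i; apply: only_trivial => j j_r.
transitivity (g ord0 * (\sum_s (g s)^`() * (f s)^`(j))
              - (g ord0)^`() * \sum_s g s * (f s)^`(j)); last first.
  by rewrite (g'f _ j_r) (gf _ (ltnW j_r)) !mulr0 subrr.
rewrite !big_ord_recl !mulrDr !mulr_sumr opprD addrACA -sumrB.
rewrite [X in _ = X + _](_ : _ = 0) ?add0r; last by ring.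
by apply: eq_bigr => i _; ring.
Qed.

Section PrimeCharacteristic.

Variable q : nat.
Hypothesis charRq : q \in [pchar R].

(* [h * p ^+ q.-1] is the ratio [h / p], of derivative zero, times [p ^+ q]. *)
Lemma deriv_mul_expr_pchar_pred p h :
  p * h^`() = p^`() * h -> (h * p ^+ q.-1)^`() = 0.
Proof.
have [n qE] : exists n, q = n.+2.
  by case: q (pcharf_prime charRq) => [|[|n]] // _; exists n.
move=> ph; have n1 : n.+1%:R = -1 :> {poly R}.
  by apply/eqP; rewrite -subr_eq0 opprK natr1 -polyC_natr -qE pcharf0.
rewrite qE derivM deriv_exp -mulr_natl n1.
transitivity ((p * h^`() - p^`() * h) * p ^+ n); first by rewrite exprS /=; ring.
by rewrite ph subrr mul0r.
Qed.

Lemma wronskian_eq0_pchar r (f : 'I_r -> {poly R}) : wronskian f = 0 ->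
  exists h : 'I_r -> {poly R}, [/\ exists s, h s != 0,
    forall s, (h s)^`() = 0 & \sum_s h s * f s = 0].
Proof.
elim: r f => [|r IHr] f.
  by move/eqP; rewrite /wronskian det_mx00 oner_eq0.
have [W'0 _ | W'_neq0] := eqVneq (wronskian (f \o lift ord0)) 0.
  have [h [[i hi0] h' hf]] := IHr _ W'0.
  exists (fun s => if unlift ord0 s is Some i then h i else 0); split.
  - by exists (lift ord0 i); rewrite liftK.
  - by move=> s; case: unliftP => [j _|_]; [exact: h' | exact: linear0].
  rewrite big_ord_recl unlift_none mul0r add0r -[RHS]hf.
  by apply: eq_bigr => j _; rewrite liftK.
case/(wronskian_minimal_relation W'_neq0) => g [g0 g_ratio gf].
exists (fun s => g s * g ord0 ^+ q.-1); split.
- by exists ord0; rewrite mulf_neq0 ?expf_neq0.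
- by move=> s; apply: deriv_mul_expr_pchar_pred.
by under eq_bigr do rewrite mulrAC; rewrite -mulr_suml gf mul0r.
Qed.

Lemma coef_deriv_eq0 h n : h^`() = 0 -> ~~ (q %| n)%N -> h`_n = 0.
Proof.
case: n => [|n] h'; first by rewrite dvdn0.
move=> q_n; have /eqP := congr1 (fun p => p`_n) h'.
rewrite coef_deriv coef0 -mulr_natr mulf_eq0 -(dvdn_pcharf charRq) (negPf q_n).
by rewrite orbF => /eqP.
Qed.

Lemma coefM_deriv_eq0 h p n b :
    h^`() = 0 -> (size p <= q)%N -> (q %| n)%N -> (b < q)%N ->
  (h * p)`_(n + b) = h`_n * p`_b.
Proof.
move=> h' p_q q_n b_q; have n_nb : (n < (n + b).+1)%N by rewrite ltnS leq_addr.
rewrite coefM (bigD1 (Ordinal n_nb)) //= addKn big1 ?addr0 // => i i_neq_n.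
have [q_i | q_i] := boolP (q %| i)%N; last by rewrite (coef_deriv_eq0 h') ?mul0r.
rewrite [p`_ _]nth_default ?mulr0 //; apply: leq_trans p_q _.
have i_nb : (i <= n + b)%N by rewrite -ltnS.
case: (ltngtP i n) => [i_n | n_i | i_n].
- by have := dvdn_leq _ (dvdn_sub q_n q_i); rewrite subn_gt0 => /(_ i_n); lia.
- by have := dvdn_leq _ (dvdn_sub q_i q_n); rewrite subn_gt0 => /(_ n_i); lia.
by case/eqP: i_neq_n; apply/val_inj.
Qed.

Lemma wronskian_neq0_pchar r (f : 'I_r -> {poly R}) :
    (forall s, size (f s) <= q)%N -> linearly_independent f ->
  wronskian f != 0.
Proof.
move=> f_q f_indep; apply/eqP => /wronskian_eq0_pchar[h [[s hs0] h' hf]].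
pose n := (size (h s)).-1.
have hn0 : (h s)`_n != 0 by rewrite -lead_coefE lead_coef_eq0.
have q_n : (q %| n)%N by apply: contraNT hn0 => /(coef_deriv_eq0 (h' s))->.
case/eqP: hn0; apply: (f_indep (fun i => (h i)`_n)).
apply/polyP => b; rewrite coef0 coef_sum.
have [b_q | q_b] := ltnP b q; last first.
  apply: big1 => i _.
  by rewrite coefZ (nth_default _ (leq_trans (f_q i) q_b)) mulr0.
have := congr1 (fun p => p`_(n + b)) hf; rewrite coef0 coef_sum => hf_nb.
by rewrite -[RHS]hf_nb; apply: eq_bigr => i _; rewrite coefM_deriv_eq0 ?coefZ.
Qed.

End PrimeCharacteristic.

End Wronskian.

Lemma size_det_leq (R : comNzRingType) n (A : 'M[{poly R}]_n) d :
  (forall i j, size (A i j) <= d.+1)%N -> (size (\det A) <= (n * d).+1)%N.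
Proof.
move=> A_d; apply: leq_trans (size_sum _ _ _) _; apply/bigmax_leqP => s _.
rewrite size_Msign; apply: leq_trans (size_poly_prod_leq _ _) _.
rewrite cardT size_enum_ord.
have : (\sum_i size (A i (s i)) <= n * d.+1)%N.
  apply: leq_trans (leq_sum _ (fun i _ => A_d _ _)) _.
  by rewrite sum_nat_const card_ord.
by rewrite mulnS leq_subLR addnS ltnS.
Qed.

(* If [C = tensor_poly f w], these sums are the coefficients of
   [(d/dx)^j C (x, u)] at [u = x + t], where [d/dx] becomes [d/dx - d/dt] in the
   coordinates [x] and [t]; neither of the two raises the degree in [x]. *)
Lemma size_sum_derivn_nderivn_leq (R : comNzRingType) r
    (f w : 'I_r -> {poly R}) k :
    (forall i, size (\sum_s f s * (w s)^`N(i))%R <= k)%N ->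
  forall j i, (size (\sum_s (f s)^`(j) * (w s)^`N(i))%R <= k)%N.
Proof.
move=> fw_k; elim=> [|j IHj] i; first exact: fw_k.
have -> : \sum_s (f s)^`(j.+1) * (w s)^`N(i) =
    (\sum_s (f s)^`(j) * (w s)^`N(i))^`()
    - (\sum_s (f s)^`(j) * (w s)^`N(i.+1)) *+ i.+1.
  rewrite raddf_sum /= -sumrMnl -sumrB; apply: eq_bigr => s _.
  by rewrite derivM deriv_nderivn mulrnAr addrK.
apply: leq_trans (size_polyD _ _) _; rewrite geq_max size_polyN -scaler_nat.
rewrite (leq_trans (size_scale_leq _ _) (IHj _)) andbT.
exact: leq_trans (size_derivn_leq _ 1) (IHj i).
Qed.

Lemma nderivn_minor_neq0 (F : fieldType) r (w : 'I_r -> {poly F}) :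
    linearly_independent w ->
  exists I : 'I_r -> nat, \det (\matrix_(s, j) (w s)^`N(I j)) != 0.
Proof.
pose n := (\max_s size (w s))%N.
pose A : 'M[F]_(r, n) := \matrix_s poly_rV (w s).
have w_n s : (size (w s) <= n)%N by exact: leq_bigmax.
move=> /(row_free_poly_rVP w_n) A_free.
have AT_full : row_full A^T by rewrite /row_full mxrank_tr.
pose I (j : 'I_r) : nat := fullrankfun AT_full j; exists I.
apply: contraTneq (fullrowsub_unit AT_full) => minor0.
rewrite unitmxE unitfE negbK -det_tr.
rewrite (_ : _^T = map_mx (horner_eval 0) (\matrix_(s, j) (w s)^`N(I j))).
  by rewrite det_map_mx minor0 rmorph0.
apply/matrixP => s j; rewrite !mxE /horner_eval horner_coef0 coef_nderivn addn0.
by rewrite binn.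
Qed.

Lemma size_wronskian_leq (F : fieldType) r (f w : 'I_r -> {poly F}) d :
    linearly_independent w ->
    (sizeY (tensor_poly f w \Po ('X + 'Y))%R <= d.+1)%N ->
  (size (wronskian f) <= (r * d).+1)%N.
Proof.
move=> /nderivn_minor_neq0[I K_neq0] /sizeY_leqP fw_d.
have [->|W_neq0] := eqVneq (wronskian f) 0; first by rewrite size_poly0.
pose K := \matrix_(s, j) (w s)^`N(I j).
apply: (@leq_trans (size (\det ((wronskian_mx f)^T *m K)))).
  by rewrite det_mulmx det_tr dvdp_leq ?mulf_neq0 ?dvdp_mulr.
apply: size_det_leq => j i; rewrite mxE; under eq_bigr do rewrite !mxE.
apply: size_sum_derivn_nderivn_leq => {}i.
by rewrite -coef_tensor_poly_comp_XaddY.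
Qed.

Section Multiplicity.

Variable F : fieldType.
Implicit Types (p : {poly F}) (a : F).

Lemma dvdp_sub_horner (C : {poly {poly F}}) p1 p2 : p1 - p2 %| C.[p1] - C.[p2].
Proof.
have /factor_theorem[D CD] : root (C - C.[p2]%:P) p2.
  by rewrite rootE !hornerE subrr.
have -> : C.[p1] - C.[p2] = (C - C.[p2]%:P).[p1].
  by rewrite hornerD hornerN hornerC.
by rewrite CD hornerM hornerXsubC dvdp_mull.
Qed.

Lemma dvdp_deriv_XsubC a m p :
  ('X - a%:P) ^+ m.+1 %| p -> ('X - a%:P) ^+ m %| p^`().
Proof.
case/dvdpP=> u ->; rewrite derivM deriv_exp /= exprS.
rewrite dvdp_add //; first by rewrite mulrA dvdp_mull.
by rewrite mulrnAr -mulrnAl mulrA dvdp_mull.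
Qed.

Lemma dvdp_derivn_XsubC a m l p :
  ('X - a%:P) ^+ (m + l) %| p -> ('X - a%:P) ^+ m %| p^`(l).
Proof.
elim: l p => [|l IHl] p; first by rewrite addn0.
by rewrite addnS => /dvdp_deriv_XsubC/IHl; rewrite derivSn.
Qed.

Lemma dvdp_XsubC_mul_simple_root a m p h : root h a -> ~~ root h^`() a ->
  ('X - a%:P) ^+ m.+1 %| p * h -> ('X - a%:P) ^+ m %| p.
Proof.
case/factor_theorem=> g ->; rewrite derivM derivXsubC mulr1 rootE hornerD.
rewrite hornerM hornerXsubC subrr mulr0 add0r => ga.
rewrite mulrA exprSr dvdp_mul2r ?polyXsubC_eq0 // Gauss_dvdpl //.
by apply: coprimep_expl; rewrite coprimep_sym coprimep_XsubC.
Qed.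

Lemma ltn_multiple_roots (rs : seq F) m p :
    p != 0 -> uniq rs -> {in rs, forall a, ('X - a%:P) ^+ m %| p} ->
  (size rs * m < size p)%N.
Proof.
move=> p_neq0 rs_uniq rs_p.
have prod_p : \prod_(a <- rs) ('X - a%:P) ^+ m %| p.
  elim: rs rs_uniq rs_p => [|a rs IHrs /= /andP[a_rs rs_uniq] rs_p].
    by rewrite big_nil dvd1p.
  rewrite big_cons Gauss_dvdp; last first.
    rewrite big_seq; apply: (big_ind (coprimep _)) => [|? ?|b b_rs].
    - exact: coprimep1.
    - by rewrite coprimepMr => -> ->.
    apply/coprimep_expl/coprimep_expr/coprimep_XsubC2.
    by rewrite subr_eq0; apply: contraNneq a_rs => <-.
  rewrite rs_p ?mem_head //=; apply: IHrs => // b b_rs.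
  by apply: rs_p; rewrite inE b_rs orbT.
apply: leq_trans (dvdp_leq p_neq0 prod_p).
rewrite prodrXl -[size rs]/(size rs).+1.-1 -(size_prod_XsubC rs id) -size_exp.
by rewrite ltn_predL size_poly_gt0 expf_neq0 // monic_neq0 // monic_prod_XsubC.
Qed.

Lemma dvdp_mul_det n (A : 'M[{poly F}]_n) (u : 'rV_n) p :
  (forall j, p %| (u *m A) 0 j) -> forall i, p %| u 0 i * \det A.
Proof.
move=> p_uA i; have -> : u 0 i * \det A = (u *m A *m \adj A) 0 i.
  by rewrite -mulmxA mul_mx_adj mul_mx_scalar mxE mulrC.
rewrite mxE; apply: (big_ind (dvdp p)); first exact: dvdp0.
  by move=> p1 p2; exact: dvdp_add.
by move=> j _; rewrite dvdp_mulr.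
Qed.

Lemma dvdp_wronskian r (f : 'I_r -> {poly F}) (v : 'I_r -> F) a M s :
    (r <= M)%N -> v s != 0 -> ('X - a%:P) ^+ M %| \sum_i v i *: f i ->
  ('X - a%:P) ^+ (M - r).+1 %| wronskian f.
Proof.
move=> r_M vs0 a_vf; pose u : 'rV[{poly F}]_r := \row_i (v i)%:P.
suff : ('X - a%:P) ^+ (M - r).+1 %| u 0 s * wronskian f.
  by rewrite mxE mul_polyC dvdpZr.
apply: dvdp_mul_det => j.
have -> : (u *m wronskian_mx f) 0 j = (\sum_i v i *: f i)^`(j).
  rewrite mxE linear_sum; apply: eq_bigr => i _.
  by rewrite !mxE linearZ mul_polyC.
apply: dvdp_derivn_XsubC; apply: dvdp_trans a_vf; apply: dvdp_exp2l.
by have := ltn_ord j; lia.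
Qed.

End Multiplicity.

Section ConstantDerivative.

Variables (F : fieldType) (L : {poly F}) (u : F).
Hypothesis deriv_L : L^`() = u%:P.
Implicit Types A : {poly F}.

Lemma derivnM_deriv_const A l :
  (A * L)^`(l.+1) = A^`(l.+1) * L + (u *+ l.+1) *: A^`(l).
Proof.
elim: l => [|l IHl].
  by rewrite derivn1 derivM deriv_L derivn0 [_ * u%:P]mulrC mul_polyC.
rewrite derivnS IHl derivD derivM deriv_L derivZ -!derivnS -addrA.
by rewrite [_ * u%:P]mulrC mul_polyC -scalerDl -mulrS.
Qed.

Lemma base_expansion c k A :
    L != 0 -> (forall l, (0 < l < c)%N -> u *+ l != 0) ->
    (size A <= c * (size L).-1)%N ->
    (forall l, (l < c)%N -> (size (A^`(l) %% L)%R <= k)%N) ->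
  exists P : {poly {poly F}},
    [/\ (size P <= c)%N, (sizeY P <= k)%N & A = P.[L]].
Proof.
move=> L_neq0; elim: c A => [|c IHc] A u_c A_c A_k.
  exists 0; split; rewrite ?horner0 ?size_poly0 //.
    by apply/sizeY_leqP => i; rewrite coef0 size_poly0.
  by apply/eqP; rewrite -size_poly_leq0.
pose B := A %% L; pose A1 := A %/ L.
have AE : A = A1 * L + B by exact: divp_eq.
have B_k : (size B <= k)%N by exact: (A_k 0%N).
have [|||P [P_c P_k A1E]] := IHc A1.
- by move=> l /andP[l0 lc]; apply: u_c; rewrite l0 ltnW.
- by rewrite size_divp // leq_subLR -mulSn.
- move=> l l_c; have ul : u *+ l.+1 != 0 by exact: u_c.
  have -> : A1^`(l) %% L = (u *+ l.+1)^-1 *: (A^`(l.+1) %% L - B^`(l.+1)).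
    rewrite {1}AE derivnD derivnM_deriv_const !modpD modp_mull add0r modpZl.
    rewrite [B^`(_) %% L]modp_small ?addrK ?scalerA ?mulVf ?scale1r //.
    exact: leq_ltn_trans (size_derivn_leq B _) (ltn_modpN0 _ L_neq0).
  apply: leq_trans (size_scale_leq _ _) _; apply: leq_trans (size_polyD _ _) _.
  by rewrite size_polyN geq_max (A_k l.+1 l_c) (leq_trans (size_derivn_leq _ _)).
exists (P * 'X + B%:P); rewrite sizeY_MXaddC_leq P_k B_k; split=> //.
  by rewrite size_MXaddC; case: ifP => // _; rewrite ltnS.
by rewrite hornerMXaddC -A1E.
Qed.

Lemma base_expansion_multiple_roots_eq0 c k (P : {poly {poly F}}) (rs : seq F) :
    u != 0 -> (size P <= c)%N -> (sizeY P <= k)%N ->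
    uniq rs -> (k <= size rs)%N -> all (root L) rs ->
    {in rs, forall a, ('X - a%:P) ^+ c %| P.[L]} ->
  P = 0.
Proof.
move=> u_neq0 P_c P_k rs_uniq k_rs /allP rsL.
elim/poly_ind: P c P_c P_k => [//|P b IHP] c P_c.
rewrite sizeY_MXaddC_leq hornerMXaddC => /andP[P_k b_k] rs_c.
have ltP_c : P != 0 -> (size P < c)%N.
  by move=> P_neq0; move: P_c; rewrite size_MXaddC (negPf P_neq0).
have b0 : b = 0.
  apply: contraTeq k_rs => b_neq0; rewrite -ltnNge (leq_trans _ b_k) //.
  have c_gt0 : (0 < c)%N.
    by apply: leq_trans P_c; rewrite size_MXaddC (negPf b_neq0) andbF.
  apply: max_poly_roots => //; apply/allP => a a_rs.
  have : ('X - a%:P) %| P.[L] * L + b.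
    by apply: dvdp_trans (rs_c a a_rs); rewrite dvdp_exp.
  by rewrite dvdp_XsubCl !rootE hornerD hornerM (eqP (rsL a a_rs)) mulr0 add0r.
have [->|P_neq0] := eqVneq P 0; first by rewrite b0 mul0r addr0.
case: c ltP_c rs_c {P_c} => [/(_ P_neq0)//|c] /(_ P_neq0) P_c rs_c.
rewrite b0 addr0 (IHP c) ?mul0r // => a a_rs.
have L'a : ~~ root L^`() a by rewrite deriv_L rootC.
apply: dvdp_XsubC_mul_simple_root (rsL a a_rs) L'a _.
by have := rs_c a a_rs; rewrite b0 addr0.
Qed.

End ConstantDerivative.

Lemma size_pseudoderiv_leq (F : fieldType) q l (A : {poly F}) :
  (size (pseudoderiv q l A) <= (pdeg q A).+1)%N.
Proof.
rewrite /pseudoderiv; have [l_A|A_l] := ltnP l (size A); last first.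
  by rewrite nderivn_poly0 // mod0p size_poly0.
apply: leq_trans (leqSpred _) _; rewrite ltnS.
exact: (leq_bigmax (F := fun l : 'I__ => (size (pseudoderiv q l A)).-1)
                   (Ordinal l_A)).
Qed.

Section PrimeCharacteristic.

Variables (F : fieldType) (q : nat).
Hypothesis charFq : q \in [pchar F].
Implicit Types (A : {poly F}) (C P : {poly {poly F}}) (rs : seq F) (a : F).

Lemma nonroots_multiplicity_bound r (f w : 'I_r -> {poly F}) d M rs s :
    wronskian f != 0 -> linearly_independent w ->
    (sizeY (tensor_poly f w \Po ('X + 'Y))%R <= d.+1)%N ->
    (r <= M)%N -> uniq rs ->
    {in rs, forall a, ~~ root (w s) a} ->
    {in rs, forall a, ('X - a%:P) ^+ M %| (tensor_poly f w).[a%:P]} ->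
  (size rs * (M - r).+1 <= r * d)%N.
Proof.
move=> W_neq0 w_indep fw_d r_M rs_uniq rs_w rs_M.
rewrite -ltnS; apply: leq_trans (size_wronskian_leq w_indep fw_d).
apply: ltn_multiple_roots => // a a_rs.
have := rs_M a a_rs; rewrite horner_tensor_poly; apply: dvdp_wronskian => //.
exact: rs_w.
Qed.

Lemma bivariate_multiplicity_bound C c d M rs :
    C != 0 -> (size C <= c)%N -> (sizeY C <= q)%N ->
    (sizeY (C \Po ('X + 'Y))%R <= d.+1)%N -> (c <= M)%N -> uniq rs ->
    {in rs, forall a, ('X - a%:P) ^+ M %| C.[a%:P]} ->
  (size rs * (M - c).+1 <= c * d + c * (M - c).+1)%N.
Proof.
move=> C_neq0 C_c C_q + c_M rs_uniq.
have [r [f [w [r_C [f_indep w_indep f_C w_C CE]]]]] :=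
  tensor_poly_rank_factorization C.
rewrite {}CE in C_neq0 *; move=> fw_d rs_M.
have r_c := leq_trans r_C C_c.
case: (pickP (predT : pred 'I_r)) => [s _|no_s]; last first.
  by rewrite /tensor_poly big_pred0 ?eqxx in C_neq0.
have W_neq0 : wronskian f != 0.
  apply: (wronskian_neq0_pchar charFq) => // i.
  exact: leq_trans (f_C i) C_q.
pose root_w a := root (w s) a.
have roots_c : (size (filter root_w rs) <= c)%N.
  apply: leq_trans (ltnW _) (leq_trans (w_C s) C_c).
  apply: max_poly_roots; rewrite ?filter_uniq ?filter_all //.
  exact: linearly_independent_neq0.
have nonroots_d : (size (filter (predC root_w) rs) * (M - r).+1 <= r * d)%N.
  apply: (@nonroots_multiplicity_bound _ _ _ d M _ s W_neq0 w_indep fw_d).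
  - exact: leq_trans r_c c_M.
  - exact: filter_uniq.
  - by move=> a; rewrite mem_filter => /andP[].
  - by move=> a; rewrite mem_filter => /andP[_ /rs_M].
have -> : size rs =
    (size (filter (predC root_w) rs) + size (filter root_w rs))%N.
  by rewrite !size_filter addnC count_predC.
rewrite mulnDl leq_add // ?leq_mul2r ?roots_c ?orbT //.
apply: leq_trans (leq_trans nonroots_d (leq_mul r_c (leqnn d))).
by rewrite leq_mul2l ltnS leq_sub2l ?orbT.
Qed.

Lemma exp_XsubC_pchar a : ('X - a%:P) ^+ q = 'X^q - (a ^+ q)%:P.
Proof.
have qnat : [pchar {poly F}].-nat q.
  by rewrite pnatE ?(pcharf_prime charFq) // pchar_poly.
by rewrite exprDn_pchar // exprNn_pchar // -polyC_exp.
Qed.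

Lemma dvdp_horner_Xq C M a : a ^+ q = a -> (M <= q)%N ->
  ('X - a%:P) ^+ M %| C.['X^q] -> ('X - a%:P) ^+ M %| C.[a%:P].
Proof.
move=> aq M_q a_M; rewrite -[C.[_]](subKr C.['X^q]) dvdp_sub //.
apply: dvdp_trans (dvdp_exp2l _ M_q) _; rewrite exp_XsubC_pchar aq.
exact: dvdp_sub_horner.
Qed.

Lemma size_Lambda : size (Lambda F q) = q.+1.
Proof.
have q_gt1 := prime_gt1 (pcharf_prime charFq).
by rewrite /Lambda size_polyDl size_polyXn // size_polyN size_polyX ltnS.
Qed.

Lemma deriv_Lambda : (Lambda F q)^`() = (-1)%:P.
Proof.
rewrite /Lambda derivB derivXn derivX -scaler_nat (pcharf0 charFq).
by rewrite scale0r sub0r rmorphN.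
Qed.

Lemma root_Lambda a : root (Lambda F q) a = (a ^+ q == a).
Proof. by rewrite rootE /Lambda !hornerE subr_eq0. Qed.

Lemma Lambda_expansion_multiplicity_bound P c d M rs :
    P != 0 -> (size P <= c)%N -> (sizeY P <= d.+1)%N ->
    (d + c <= q)%N -> (c <= M <= q)%N -> uniq rs -> all (root (Lambda F q)) rs ->
    {in rs, forall a, ('X - a%:P) ^+ M %| P.[Lambda F q]} ->
  (size rs * (M - c).+1 <= c * d + c * (M - c).+1)%N.
Proof.
move=> P_neq0 P_c P_d dc_q /andP[c_M M_q] rs_uniq /allP rs_L rs_M.
pose C : {poly {poly F}} := P \Po ('X - 'Y).
have PC : P = C \Po ('X + 'Y).
  by rewrite -comp_polyA comp_polyB comp_polyX comp_polyC addrK comp_polyXr.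
have sizeC : size C = size P by rewrite size_comp_poly2 ?size_XsubC.
apply: (@bivariate_multiplicity_bound C) => //.
- by rewrite -size_poly_eq0 sizeC size_poly_eq0.
- by rewrite sizeC.
- apply: leq_trans dc_q; rewrite /C -polyCN.
  apply: leq_trans (sizeY_comp_XaddC _ _) _; rewrite size_polyN size_polyX muln1.
  move: P_neq0 P_c; rewrite -size_poly_gt0; case: (size P) => // n _ n_c.
  by have := leq_add P_d n_c; rewrite addnS.
- by rewrite -PC.
move=> a a_rs; apply: dvdp_horner_Xq M_q _.
  by apply/eqP; rewrite -root_Lambda rs_L.
by rewrite horner_comp !hornerE; exact: rs_M.
Qed.

Lemma Lambda_expansion c A : (c <= q)%N -> (size A <= c * q)%N ->
  exists P : {poly {poly F}}, [/\ (size P <= c)%N, (sizeY P <= (pdeg q A).+1)%N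
    & A = P.[Lambda F q]].
Proof.
move=> c_q A_c; apply: (base_expansion deriv_Lambda) => [|l||l _].
- by rewrite -size_poly_gt0 size_Lambda.
- case/andP=> l_gt0 l_c; rewrite mulNrn oppr_eq0 -(dvdn_pcharf charFq).
  by rewrite gtnNdvd // (leq_trans l_c).
- by rewrite size_Lambda.
rewrite nderivn_def -scaler_nat modpZl; apply: leq_trans (size_scale_leq _ _) _.
exact: size_pseudoderiv_leq.
Qed.

Section MultipleRoots.

Variables (A : {poly F}) (c M : nat) (rs : seq F).
Hypotheses (A_neq0 : A != 0) (A_c : (size A <= c * q)%N).
Hypotheses (c_M : (c <= M)%N) (M_q : (M <= q)%N).
Hypotheses (rs_uniq : uniq rs) (rs_L : all (root (Lambda F q)) rs).
Hypothesis rs_M : {in rs, forall a, ('X - a%:P) ^+ M %| A}.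

Lemma multiple_roots_leq_pdeg : (size rs <= pdeg q A)%N.
Proof.
have [P [P_c P_d AP]] := Lambda_expansion (leq_trans c_M M_q) A_c.
rewrite leqNgt; apply: contra A_neq0 => d_rs.
rewrite AP (_ : P = 0) ?horner0 //.
apply: (base_expansion_multiple_roots_eq0 deriv_Lambda _ P_c P_d
          rs_uniq d_rs rs_L) => [|a /rs_M].
  by rewrite oppr_eq0 oner_eq0.
by rewrite -AP; apply: dvdp_trans; exact: dvdp_exp2l.
Qed.

Lemma multiple_roots_bound :
  (size rs * (M - c).+1 <= c * pdeg q A + c * (M - c).+1)%N.
Proof.
have [P [P_c P_d AP]] := Lambda_expansion (leq_trans c_M M_q) A_c.
have [dc_q | q_dc] := leqP (pdeg q A + c) q.
  apply: (Lambda_expansion_multiplicity_bound _ P_c P_d); rewrite -?AP ?c_M //.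
  by apply: contraNneq A_neq0 => P0; rewrite AP P0 horner0.
have [rs_c | c_rs] := leqP (size rs) c.
  by apply: leq_trans (leq_addl _ _); rewrite leq_mul2r rs_c orbT.
apply: leq_trans (leq_addr _ _).
have rsM_cq := leq_trans (ltn_multiple_roots A_neq0 rs_uniq rs_M) A_c.
case: c c_M q_dc c_rs rsM_cq => // n n_M q_dn n_rs rsM_nq.
rewrite -(leq_add2r (size rs * n)) -mulnDr addSnnS subnK //.
apply: leq_trans (ltnW rsM_nq) _; apply: (@leq_trans (n.+1 * (pdeg q A + n))).
  by rewrite leq_mul2l -ltnS -addnS.
by rewrite mulnDr leq_add2l leq_mul2r (ltnW n_rs) orbT.
Qed.

End MultipleRoots.

End PrimeCharacteristic.

Unset Implicit Arguments.

Theorem theorem5p4 (q c k M : nat) (A : {poly 'F_q}) :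
  prime q -> (0 < c)%N -> (0 < k)%N -> (0 < M)%N ->
  (c < M)%N -> (M < q)%N ->
  A != 0 -> (size A <= c * q)%N -> (pdeg q A < k)%N ->
  let N := #|[set a : 'F_q | (M <= mult A a)%N]| in
  (N%:R : rat) <= (c%:R / (M - c + 1)%:R) * k%:R + c%:R /\ (N <= k)%N.
Proof.
move=> q_prime _ _ _ /ltnW c_M /ltnW M_q A_neq0 A_c A_k N.
have charFq := pchar_Fp q_prime.
pose rs := enum [set a : 'F_q | (M <= mult A a)%N].
have rs_uniq : uniq rs by exact: enum_uniq.
have rs_L : all (root (Lambda 'F_q q)) rs.
  apply/allP => a _.
  by rewrite root_Lambda -[X in _ ^+ X](card_Fp q_prime) expf_card.
have rs_M : {in rs, forall a, ('X - a%:P) ^+ M %| A}.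
  by move=> a; rewrite mem_enum inE /mult mup_geq.
have := multiple_roots_bound charFq A_neq0 A_c c_M M_q rs_uniq rs_L rs_M.
have := multiple_roots_leq_pdeg charFq A_neq0 A_c c_M M_q rs_uniq rs_L rs_M.
rewrite -[size rs]cardE -/N -addn1 => N_d N_Mc.
split; last exact: leq_trans N_d (ltnW A_k).
have Mc_gt0 : 0 < (M - c + 1)%:R :> rat by rewrite ltr0n addn1.
rewrite -(ler_pM2r Mc_gt0) mulrDl mulrAC mulfVK ?lt0r_neq0 //.
rewrite -!natrM -natrD ler_nat (leq_trans N_Mc) // leq_add2r leq_mul2l.
by rewrite (ltnW A_k) orbT.
Qed.
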